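(* Let $f\in L^\infty_{\mathbb R}(\mathbb T)$ and let $\epsilon>0$. Then there exist a function $g\in H^\infty(\mathbb T)$ and a measurable set $E\subset\mathbb T$ such that $|\mathbb T\setminus E|<\epsilon$ and $$f=\operatorname{Re} g\quad\text{on } E.$$
   Context: $\mathbb T$ is the unit circle and $|\cdot|$ denotes Lebesgue (arc length) measure on $\mathbb T$. $L^\infty_{\mathbb R}(\mathbb T)$ is the space of real-valued essentially bounded measurable functions on $\mathbb T$. $H^\infty(\mathbb T)$ is the space of (a.e. defined) boundary values on $\mathbb T$ of bounded analytic functions on the unit disk. Functions on $\mathbb T$ are identified when they agree almost everywhere. *)

(* Defs.v *)
From HB Require Import structures.
From mathcomp Require Import all_boot all_order all_algebra.
From mathcomp Require Import complex.
From mathcomp Require Import all_classical all_reals all_analysis.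

Set Implicit Arguments.
Unset Strict Implicit.
Unset Printing Implicit Defensive.

Import Order.TTheory GRing.Theory Num.Theory numFieldNormedType.Exports.

Local Open Scope classical_set_scope.
Local Open Scope ring_scope.
Local Open Scope complex_scope.

(* The real line with the Lebesgue (not Borel) sigma-algebra, on which
   completed_lebesgue_measure is defined. *)
Notation lebesgueType R := (caratheodory_type (@wlength R idfun)^*%mu).

Definition circle (R : realType) := {z : R[i] | `|z| == 1}.

HB.instance Definition _ (R : realType) := Choice.on (circle R).

Section circle.
Context {R : realType}.

Let cis (t : R) : R[i] := cos t +i* sin t.

Let norm_cis (t : R) : `|cis t| == 1.
Proof. by rewrite normc_def /= cos2Dsin2 sqrtr1. Qed.

(* t |-> e^(it) *)
Definition expi (t : R) : circle R := exist _ (cis t) (norm_cis t).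

HB.instance Definition _ := isPointed.Build (circle R) (expi 0).

(* As expi is 2pi-periodic and maps [0, 2pi[ bijectively onto the circle, this
   is the transport of the Lebesgue sigma-algebra of [0, 2pi[. *)
Definition circle_measurable : set (set (circle R)) :=
  image_set_system setT (expi : lebesgueType R -> circle R) measurable.

Let circle_sigma_algebra : sigma_algebra setT circle_measurable.
Proof. by apply: sigma_algebra_image; exact: sigma_algebra_measurable. Qed.

Let circle_measurable0 : circle_measurable set0.
Proof. by case: circle_sigma_algebra. Qed.

Let circle_measurableC A : circle_measurable A -> circle_measurable (~` A).
Proof.
by move=> mA; rewrite -setTD; case: circle_sigma_algebra => _ mC _; exact: mC.
Qed.

Let circle_measurable_bigcup (F : (set (circle R))^nat) :
  (forall n, circle_measurable (F n)) -> circle_measurable (\bigcup_n F n).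
Proof. by case: circle_sigma_algebra => _ _; exact. Qed.

HB.instance Definition _ := @isMeasurable.Build default_measure_display
  (circle R) circle_measurable circle_measurable0 circle_measurableC
  circle_measurable_bigcup.

Let measurable_expi :
  measurable_fun [set: lebesgueType R] (expi : lebesgueType R -> circle R).
Proof. by move=> _ A mA; exact: mA. Qed.

Let measurable_period : measurable (`[0, 2 * pi[ : set (lebesgueType R)).
Proof.
apply: sub_caratheodory.
exact: (measurable_itv `[0, 2 * pi[ : measurable (_ : set (measurableTypeR R))).
Qed.

Definition arc_length : set (circle R) -> \bar R :=
  pushforward (mrestr (@completed_lebesgue_measure R) measurable_period) expi.

HB.instance Definition _ := Measure.copy arc_length
  (measure_function_pushforward__canonical__measure_function_Measure
    (mrestr completed_lebesgue_measure measurable_period) measurable_expi).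

End circle.

Section hardy.
Context {R : realType}.

(* R[i]^o is R[i] as a normed module over itself, so that derivable is
   complex differentiability; the order on R[i] forces both sides of an
   inequality between norms to be real. *)
Definition bounded_analytic (G : R[i]^o -> R[i]^o) :=
  (forall z : R[i], `|z| < 1 -> derivable G z 1) /\
  (exists M : R, forall z : R[i], `|z| < 1 -> `|G z| <= M%:C).

(* g represents a class in H^oo of the circle: almost everywhere it is the
   radial limit of some bounded analytic function on the disk. *)
Definition Hoo (g : circle R -> R[i]^o) :=
  exists2 G : R[i]^o -> R[i]^o, bounded_analytic G &
  {ae arc_length, forall w : circle R,
    G (r%:C * val w) @[r --> (1 : R)^'-] --> g w}.

End hardy.

(* Main.v *)
Require Import Defs.
From mathcomp Require Import all_boot all_order all_algebra.
From mathcomp Require Import complex.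
From mathcomp Require Import all_classical all_reals all_analysis.
From mathcomp Require Import measurable_realfun ring lra zify.
Import Order.TTheory GRing.Theory Num.Theory numFieldNormedType.Exports.
Import ComplexField.Normc.
Local Open Scope classical_set_scope.
Local Open Scope ring_scope.

(* Idea: by Lusin and Tietze we may assume that f is continuous on the line,
   in the parameter t of e^(it). If |f| <= M, a Riemann sum of truncated Poisson
   kernels is a polynomial P(z) with P(0) real, |Re P| <= 2 M on the closed disk
   and Re P close to f on most of the circle. As the mean of P^2 is
   P(0)^2 >= 0, the L^2 norm of Im P is at most that of Re P, so |Im P| is large
   only on a small set. The Moebius map z -> lam z / (lam - z) (for M = 1) is
   bounded by lam on the strip |Re z| <= 2 and close to the identity where
   lam is large compared with (Im z)^2; composing it with P and expanding the
   geometric series around a point far to the left gives a polynomial Q with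
   |Q| <= 2 lam M and |f - Re Q| <= M / 4 outside a set of measure O(1 / lam).
   Iterating on the remainder, clamped to [-M / 4, M / 4], with lam doubled at
   each step gives a uniformly convergent series of polynomials, whose sum lies
   in the disk algebra and has real part f outside a set of small measure. *)

Local Notation Re := complex.Re.
Local Notation Im := complex.Im.

(** Convertible with [val (expi t)], so that facts about [cis] transfer to the circle by
    computation. *)
Definition cis {R : realType} (t : R) : R[i] := Complex (cos t) (sin t).

(** * The real-valued modulus and the points e^(it) *)

Section complex_modulus.
Context {R : realType}.
Implicit Types (z w : R[i]) (x y t : R).

Lemma ReD z w : Re (z + w) = Re z + Re w. Proof. by case: z; case: w. Qed.
Lemma ImD z w : Im (z + w) = Im z + Im w. Proof. by case: z; case: w. Qed.
Lemma ReB z w : Re (z - w) = Re z - Re w. Proof. by case: z; case: w. Qed.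
Lemma ImB z w : Im (z - w) = Im z - Im w. Proof. by case: z; case: w. Qed.
Lemma Re_mul z w : Re (z * w) = Re z * Re w - Im z * Im w.
Proof. by case: z; case: w. Qed.
Lemma Im_mul z w : Im (z * w) = Re z * Im w + Im z * Re w.
Proof. by case: z; case: w. Qed.

Lemma Re_real x : Re (x%:C)%C = x. Proof. by []. Qed.
Lemma Im_real x : Im (x%:C)%C = 0. Proof. by []. Qed.

Lemma Re_sum (I : Type) (r : seq I) (P : pred I) (F : I -> R[i]) :
  Re (\sum_(i <- r | P i) F i) = \sum_(i <- r | P i) Re (F i).
Proof. by elim/big_rec2: _ => [|i x z _ <-]; rewrite ?ReD. Qed.

Lemma Im_sum (I : Type) (r : seq I) (P : pred I) (F : I -> R[i]) :
  Im (\sum_(i <- r | P i) F i) = \sum_(i <- r | P i) Im (F i).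
Proof. by elim/big_rec2: _ => [|i x z _ <-]; rewrite ?ImD. Qed.

Lemma normc_sqr z : normc z ^+ 2 = Re z ^+ 2 + Im z ^+ 2.
Proof. by case: z => a b; rewrite /= sqr_sqrtr// addr_ge0// sqr_ge0. Qed.

Lemma normc_ge0 z : 0 <= normc z.
Proof. by case: z => a b; exact: sqrtr_ge0. Qed.

Lemma normr_normc z : `|z| = ((normc z)%:C)%C. Proof. by []. Qed.

Lemma normcD z w : normc (z + w) <= normc z + normc w.
Proof. exact: (le_normcD z w). Qed.

Lemma normc_opp z : normc (- z) = normc z. Proof. exact: (normcN z). Qed.

Lemma normcB z w : normc (z - w) <= normc z + normc w.
Proof. by rewrite -[normc w]normc_opp; exact: normcD. Qed.

Lemma normcX z n : normc (z ^+ n) = normc z ^+ n.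
Proof. by elim: n => [|n IH]; rewrite ?normc1// !exprS normcM IH. Qed.

Lemma normc_real x : normc (x%:C)%C = `|x|.
Proof. by rewrite /= expr0n addr0 sqrtr_sqr. Qed.

Lemma normc_nat n : normc (n%:R : R[i]) = n%:R.
Proof.
by rewrite -[n%:R](rmorph_nat (real_complex R)) normc_real ger0_norm.
Qed.

Lemma normc_sum (I : Type) (r : seq I) (P : pred I) (F : I -> R[i]) :
  normc (\sum_(i <- r | P i) F i) <= \sum_(i <- r | P i) normc (F i).
Proof.
elim/big_ind2: _ => [|x1 x2 y1 y2 h1 h2|//]; first by rewrite normc0.
by rewrite (le_trans (normcD _ _))// lerD.
Qed.

Lemma Re_le_normc z : `|Re z| <= normc z.
Proof.
rewrite -(ler_pXn2r (n := 2))// ?nnegrE ?normc_ge0//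
  normc_sqr real_normK ?num_real//.
by rewrite lerDl sqr_ge0.
Qed.

Lemma Im_le_normc z : `|Im z| <= normc z.
Proof.
rewrite -(ler_pXn2r (n := 2))// ?nnegrE ?normc_ge0//
  normc_sqr real_normK ?num_real//.
by rewrite lerDr sqr_ge0.
Qed.

Lemma normc_le_ReIm z : normc z <= `|Re z| + `|Im z|.
Proof.
rewrite -(ler_pXn2r (n := 2))// ?nnegrE ?normc_ge0 ?addr_ge0//.
rewrite normc_sqr -(real_normK (num_real (Re z))).
rewrite -(real_normK (num_real (Im z))).
by rewrite sqrrD lerD2r lerDl mulrn_wge0// mulr_ge0.
Qed.

Lemma normc_cis t : normc (cis t) = 1.
Proof. by rewrite /= cos2Dsin2 sqrtr1. Qed.

Lemma cisD s t : cis (s + t) = cis s * cis t.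
Proof. by apply/eqP; rewrite eq_complex /= cosD sinD eqxx addrC eqxx. Qed.

Lemma cis0 : cis 0 = 1 :> R[i].
Proof. by rewrite /cis cos0 sin0. Qed.

Lemma cisX t n : cis t ^+ n = cis (n%:R * t).
Proof.
elim: n => [|n IH]; first by rewrite expr0 mul0r cis0.
by rewrite exprS IH -cisD -natr1 mulrDl mul1r addrC.
Qed.

Lemma cis2pi : cis (2 * pi) = 1 :> R[i].
Proof. by rewrite /cis mulr_natl cos2pi sin2pi. Qed.

Lemma cos_neq1 t : 0 < t < 2 * pi -> cos t != 1.
Proof.
move=> /andP[t0 t2]; have -> : t = (t / 2) *+ 2 by rewrite -mulr_natr mulfVK.
have s0 : 0 < sin (t / 2) by apply: sin_gt0_pi; apply/andP; split; lra.
rewrite cos_mulr2n cos2sin2; apply/eqP => h.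
have : 0 < sin (t / 2) ^+ 2 by rewrite exprn_gt0.
by move: h; rewrite -mulr_natr; lra.
Qed.

End complex_modulus.

(** * Cauchy-type estimates for polynomials, by averaging over roots of unity *)

Section polynomials_on_the_disk.
Context {R : realType}.
Implicit Types (q : {poly R[i]}) (z w : R[i]).

Lemma cis_unity_prim N : (0 < N)%N ->
  N.-primitive_root (cis (2 * pi / N%:R) : R[i]).
Proof.
move=> N0; have N0' : 0 < N%:R :> R by rewrite ltr0n.
have pi0 := @pi_gt0 R.
apply/andP; split => //; apply/forallP => -[i iN] /=; apply/eqP.
rewrite unity_rootE cisX; have [->|neq] := eqVneq i.+1 N.
  by rewrite [N%:R * _]mulrC mulfVK ?cis2pi ?eqxx// pnatr_eq0 -lt0n.
apply/negbTE; rewrite eq_complex /= negb_and cos_neq1//; apply/andP; split.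
  by rewrite mulr_gt0// divr_gt0// mulr_gt0.
rewrite mulrA ltr_pdivrMr// [ltLHS]mulrC ltr_pM2l ?mulr_gt0// ltr_nat.
by rewrite ltn_neqAle neq.
Qed.

(** If [N] does not divide [m], the ratio differs from 1 and the geometric sum vanishes. This
    discrete orthogonality serves both the coefficient estimate and the Riemann sums of kernels. *)
Lemma sum_unity_roots N m : (0 < N)%N ->
  \sum_(j < N) (cis (2 * pi / N%:R) ^+ m) ^+ j =
  (if (N %| m)%N then N%:R else 0) :> R[i].
Proof.
move=> N0; have pr := cis_unity_prim _ N0; rewrite (prim_order_dvd pr).
case: ifPn => [/eqP ->|ne1].
  by rewrite (eq_bigr (fun=> 1)) ?sumr_const ?card_ord// => i _; rewrite expr1n.
apply: (mulfI (x := cis (2 * pi / N%:R) ^+ m - 1)); first by rewrite subr_eq0.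
by rewrite -subrX1 -exprM mulnC exprM (prim_expr_order pr) expr1n subrr mulr0.
Qed.

(** Cauchy's estimate: averaging q(w) w^(-k) over the [N]-th roots of unity isolates the coefficient
    once [N] exceeds [k] and the degree. The exponent [N - k] plays the role of -k. *)
Lemma poly_coef_bound q (A : R) k :
  (forall z, normc z = 1 -> normc q.[z] <= A) -> normc q`_k <= A.
Proof.
move=> qA; pose N := maxn (size q) k.+1.
have N0 : (0 < N)%N by rewrite leq_max orbT.
have kN : (k < N)%N by rewrite leq_max leqnn orbT.
pose om : R[i] := cis (2 * pi / N%:R).
have om1 m : normc (om ^+ m) = 1 by rewrite normcX normc_cis expr1n.
have sumE : \sum_(j < N) q.[om ^+ j] * (om ^+ j) ^+ (N - k) = N%:R * q`_k.
  under eq_bigr => j _.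
    rewrite (horner_coef_wide _ (leq_maxl _ k.+1)) -/N mulr_suml.
    under eq_bigr => l _.
      rewrite -mulrA -exprD -exprM mulnC exprM.
      over.
    over.
  rewrite exchange_big /=.
  under eq_bigr => l _.
    rewrite -mulr_sumr sum_unity_roots//.
    over.
  rewrite (bigD1 (Ordinal kN)) //= subnKC; last exact: ltnW.
  rewrite dvdnn big1 ?addr0 1?mulrC// => l lk.
  (* The exponent l + (N - k) lies strictly between 0 and 2 N, so it is a multiple of [N] only for l
     = k. *)
  rewrite ifF ?mulr0//; apply/negbTE/negP => /dvdnP[c].
  have ltN := ltn_ord l; have lk' : (l : nat) != k by [].
  by case: c => [|[|c]]; rewrite ?mul0n ?mul1n ?mulSn; move: lk' => /eqP; lia.
have N0' : 0 < N%:R :> R by rewrite ltr0n.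
rewrite -(ler_pM2l N0') -normc_nat -normcM -sumE (le_trans (normc_sum _ _ _
  _))//.
rewrite normc_nat mulr_natl -[N in leRHS]card_ord -sumr_const ler_sum// => j _.
by rewrite normcM -exprM om1 mulr1 qA.
Qed.

Lemma geometric_sum_le (r : R) n : 0 <= r < 1 ->
  \sum_(i < n) r ^+ i <= (1 - r)^-1.
Proof.
move=> /andP[r0 r1]; have r1' : 0 < 1 - r by rewrite subr_gt0.
rewrite -(ler_pM2l r1') divff ?gt_eqF//.
have := subrX1 r n; rewrite -[r - 1]opprB mulNr => /(congr1 (@GRing.opp R)).
by rewrite opprK opprB => <-; rewrite lerBlDr lerDl exprn_ge0.
Qed.

(** Cauchy's estimate on each coefficient, then a geometric series: cruder than the maximum
    principle, but the loss 1 / (1 - r) is harmless on a fixed smaller disk. *)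
Lemma poly_disk_bound q (A r : R) z :
  (forall z, normc z = 1 -> normc q.[z] <= A) -> r < 1 -> normc z <= r ->
  normc q.[z] <= A / (1 - r).
Proof.
move=> qA r1 zr; have r0 : 0 <= r by rewrite (le_trans (normc_ge0 z)).
have A0 : 0 <= A by rewrite (le_trans (normc_ge0 q.[1])) ?qA ?normc1.
rewrite horner_coef (le_trans (normc_sum _ _ _ _))//.
apply: (@le_trans _ _ (\sum_(i < size q) A * r ^+ i)).
  apply: ler_sum => i _; rewrite normcM normcX ler_pM ?exprn_ge0 ?normc_ge0//.
    exact: poly_coef_bound.
  by rewrite lerXn2r ?nnegrE ?normc_ge0.
by rewrite -mulr_sumr ler_wpM2l ?geometric_sum_le// r0.
Qed.

(** On the unit circle |w - z| >= 1 - r, so the divided difference (q - q(z)) / (X - z) inherits a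
    bound from [q]. One such division gives the derivative at [z], two give the second-order Taylor
    remainder. *)
Lemma poly_quotient_bound q (A r : R) z :
  (forall z, normc z = 1 -> normc q.[z] <= A) -> r < 1 -> normc z <= r ->
  exists2 q1 : {poly R[i]}, q = q.[z]%:P + q1 * ('X - z%:P) &
  forall w, normc w = 1 -> normc q1.[w] <= 2 * A / (1 - r) ^+ 2.
Proof.
move=> qA r1 zr; have r0 : 0 <= r by rewrite (le_trans (normc_ge0 z)).
have A0 : 0 <= A by rewrite (le_trans (normc_ge0 q.[1])) ?qA ?normc1.
have r1' : 0 < 1 - r by rewrite subr_gt0.
have /factor_theorem[q1 q1E] : root (q - q.[z]%:P) z.
  by rewrite rootE hornerD hornerN hornerC subrr.
have qE : q = q.[z]%:P + q1 * ('X - z%:P) by rewrite -q1E addrC subrK.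
exists q1 => // w w1.
have /(congr1 (horner^~ w)) := q1E; rewrite hornerM !hornerE /= => e.
have wz : 1 - r <= normc (w - z).
  by have := normcD (w - z) z; rewrite subrK w1; lra.
have wz0 : 0 < normc (w - z) by exact: lt_le_trans wz.
have qz : normc q.[z] <= A / (1 - r) by exact: poly_disk_bound.
have h : normc q1.[w] * normc (w - z) <= A + A / (1 - r).
  by rewrite -normcM -e (le_trans (normcB _ _))// lerD// qA.
apply: (@le_trans _ _ ((A + A / (1 - r)) / (1 - r))).
  by rewrite ler_pdivlMr// (le_trans _ h)// ler_wpM2l// normc_ge0.
rewrite expr2 invfM mulrA ler_pM2r ?invr_gt0//.
have : A <= A / (1 - r) by rewrite ler_pdivlMr//; nra.
by rewrite -mulrA; lra.
Qed.

Lemma poly_deriv_bound q (A r : R) z :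
  (forall z, normc z = 1 -> normc q.[z] <= A) -> r < 1 -> normc z <= r ->
  normc q^`().[z] <= 2 * A / (1 - r) ^+ 3.
Proof.
move=> qA r1 zr; have [q1 qE q1A] := poly_quotient_bound _ _ _ _ qA r1 zr.
rewrite qE derivD derivC add0r derivM derivXsubC !hornerE /= subrr mulr0 add0r.
by rewrite exprSr invfM mulrA; exact: poly_disk_bound.
Qed.

Lemma poly_taylor2_bound q (A r : R) z w :
  (forall z, normc z = 1 -> normc q.[z] <= A) -> r < 1 ->
  normc z <= r -> normc w <= r ->
  normc (q.[w] - q.[z] - (w - z) * q^`().[z]) <=
    4 * A / (1 - r) ^+ 5 * normc (w - z) ^+ 2.
Proof.
move=> qA r1 zr wr; have [q1 qE q1A] := poly_quotient_bound _ _ _ _ qA r1 zr.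
have [q2 q1E q2A] := poly_quotient_bound _ _ _ _ q1A r1 zr.
have q'E : q^`().[z] = q1.[z].
  rewrite [in LHS]qE derivD derivC add0r derivM derivXsubC !hornerE /=.
  by rewrite subrr mulr0 add0r.
have -> : q.[w] - q.[z] - (w - z) * q^`().[z] = q2.[w] * (w - z) ^+ 2.
  rewrite q'E [in q.[w]]qE [in q1 * _]q1E !hornerE /=; ring.
rewrite normcM normcX ler_wpM2r ?exprn_ge0 ?normc_ge0//.
have -> : 4 * A / (1 - r) ^+ 5 = 2 * (2 * A / (1 - r) ^+ 2) / (1 - r) ^+ 2 /
  (1 - r).
  by field; rewrite subr_eq0 gt_eqF.
exact: poly_disk_bound.
Qed.

End polynomials_on_the_disk.

(** * Uniform limits of polynomials on the disk *)

Section limits_of_polynomials.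
Context {R : realType}.
Implicit Types (z w : R[i]).

(** The intervals around [x n] of radius 2 C / 2^n, a bound for all remaining steps together, are
    nested; the supremum of their left ends lies in each of them. *)
Lemma half_pow_lim (C : R) (x : nat -> R) : 0 <= C ->
  (forall n, `|x n.+1 - x n| <= C / 2 ^+ n) ->
  exists l, forall n, `|x n - l| <= 2 * C / 2 ^+ n.
Proof.
move=> C0 xC; pose lo n := x n - 2 * C / 2 ^+ n;
  pose up n := x n + 2 * C / 2 ^+ n.
have stepE n : 2 * C / 2 ^+ n = 2 * C / 2 ^+ n.+1 + C / 2 ^+ n.
  by rewrite exprS; field; rewrite expf_neq0.
have lo_step n : lo n <= lo n.+1.
  have := xC n; have := stepE n; rewrite /lo ler_norml => h /andP[h1 h2]; lra.
have up_step n : up n.+1 <= up n.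
  have := xC n; have := stepE n; rewrite /up ler_norml => h /andP[h1 h2]; lra.
have lo_up n : lo n <= up n.
  have h : 0 <= 2 * C / 2 ^+ n by rewrite divr_ge0// mulr_ge0.
  rewrite /lo /up; lra.
have lo_mono : {homo lo : m n / (m <= n)%N >-> m <= n}.
  by apply: homo_leq => // y z w; exact: le_trans.
have up_mono : {homo up : m n / (m <= n)%N >-> n <= m}.
  by apply: homo_leq => // y z w h1 h2; exact: le_trans h2 h1.
have lo_le_up m n : lo m <= up n.
  have [mn|/ltnW nm] := leqP m n.
    by rewrite (le_trans (lo_mono _ _ mn)).
  by rewrite (le_trans (lo_up m))// up_mono.
exists (sup (range lo)) => n; rewrite ler_norml.
have h1 : lo n <= sup (range lo).
  by apply: ub_le_sup; [exists (up 0%N) => _ [m _ <-]|exists n].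
have h2 : sup (range lo) <= up n.
  by apply: ge_sup; [exists (lo 0%N), 0%N|move=> _ [m _ <-]].
move: h1 h2; rewrite /lo /up => h1 h2; apply/andP; split; lra.
Qed.

Lemma half_pow_limc (C : R) (x : nat -> R[i]) : 0 <= C ->
  (forall n, normc (x n.+1 - x n) <= C / 2 ^+ n) ->
  exists l, forall n, normc (x n - l) <= 4 * C / 2 ^+ n.
Proof.
move=> C0 xC.
have [n|a aP] := half_pow_lim C (fun n => Re (x n)) C0.
  by rewrite -ReB (le_trans (Re_le_normc _)).
have [n|b bP] := half_pow_lim C (fun n => Im (x n)) C0.
  by rewrite -ImB (le_trans (Im_le_normc _)).
exists (Complex a b) => n; rewrite (le_trans (normc_le_ReIm _))// ReB ImB /=.
have := aP n; have := bP n; lra.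
Qed.

Lemma half_pow_small (e K : R) : 0 < e -> exists n, K / 2 ^+ n < e.
Proof.
move=> e0; pose n := Num.bound (`|K| / e).
have h : `|K| / e < n%:R by rewrite archi_boundP// divr_ge0// ltW.
exists n; rewrite ltr_pdivrMr ?exprn_gt0// (le_lt_trans (ler_norm K))//.
move: h; rewrite ltr_pdivrMr// => h; rewrite (lt_le_trans h)// mulrC ler_pM2l//.
by rewrite -natrX ler_nat ltnW// ltn_expl.
Qed.

Lemma le_half_pow (x y K : R) : (forall n, x <= y + K / 2 ^+ n) -> x <= y.
Proof.
move=> h; rewrite leNgt; apply/negP => yx.
have [|n hn] := half_pow_small (x - y) K; first by rewrite subr_gt0.
by have := h n; lra.
Qed.

Lemma derivable_quadratic (G : R[i]^o -> R[i]^o) z (D : R[i]) (K r : R) :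
  0 < r ->
  (forall w, normc (w - z) <= r ->
     normc (G w - G z - (w - z) * D) <= K * normc (w - z) ^+ 2) ->
  derivable G z 1.
Proof.
move=> r0 GK; apply/cvg_ex; exists (D : R[i]^o).
(* A positive [e] in [R[i]] is real: its imaginary part vanishes and [Re e] is the actual
   tolerance. *)
apply/cvgrPdist_lt => e; rewrite ltcE /= => /andP[/eqP Ime e0].
have K0 : 0 < `|K| + 1 by rewrite ltr_wpDl.
pose d := Num.min r (Re e / (`|K| + 1)).
have d0 : 0 < d by rewrite /d lt_min r0 divr_gt0.
near=> h.
have h0 : h != 0 by near: h; exact: (@nbhs_dnbhs_neq (R[i]^o)).
have hd : normc h < d.
  rewrite -ltcR -normr_normc; near: h; apply: (@dnbhs0_lt _ (R[i]^o)).
  by rewrite ltcR.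
have hn : 0 < normc h.
  by rewrite lt_neqAle normc_ge0 eq_sym andbT;
    apply: contra h0 => /eqP/eq0_normc->.
rewrite normr_normc ltcE /= Ime eqxx /=.
have /= := GK (h + z); rewrite addrK => /(_ _).
have hr : normc h <= r by rewrite ltW// (lt_le_trans hd)// ge_min lexx.
move=> /(_ hr) hb.
have -> : D - h^-1 *: (G (h *: 1 + z) - G z) = - (h^-1 * (G (h + z) - G z - h
  * D)).
  by rewrite /GRing.scale /= mulr1; field.
rewrite normc_opp normcM normcV mulrC ltr_pdivrMr// (le_lt_trans hb)//.
rewrite expr2 mulrA ltr_pM2r//.
have : normc h < Re e / (`|K| + 1) by rewrite (lt_le_trans hd)//
  ge_min lexx orbT.
rewrite ltr_pdivlMr// => h2;
  rewrite (le_lt_trans _ h2)// mulrC ler_wpM2l// ?normc_ge0//.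
by rewrite (le_trans (ler_norm K))// lerDl.
Unshelve. all: by end_near. Qed.

(** The derivatives at a point of the open disk also converge geometrically, and the quadratic
    Taylor bounds, uniform in [n], pass to the limit. Outside the closed disk [G] is arbitrary. *)
Lemma disk_algebra_limit (S : nat -> {poly R[i]}) (C : R) : 0 <= C ->
  S 0%N = 0 ->
  (forall n z, normc z <= 1 ->
     normc ((S n.+1).[z] - (S n).[z]) <= C / 2 ^+ n) ->
  exists G : R[i]^o -> R[i]^o,
    (forall n z, normc z <= 1 -> normc ((S n).[z] - G z) <= 4 * C / 2 ^+ n) /\
    (forall z, normc z < 1 -> derivable G z 1).
Proof.
move=> C0 S0 SC.
have /choice[G GS] : forall z, exists l, normc z <= 1 ->
    forall n, normc ((S n).[z] - l) <= 4 * C / 2 ^+ n.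
  move=> z; have [z1|z1] := leP (normc z) 1; last by exists 0; lra.
  have [n|l lP] := half_pow_limc C (fun n => (S n).[z]) C0; first exact: SC.
  by exists l.
exists G; split => [n z z1|z z1]; first exact: GS.
(* Since [S 0%N = 0], both |G| and |S n - G| are at most 4 C on the circle. *)
have S_bound n w : normc w = 1 -> normc (S n).[w] <= 8 * C.
  move=> w1; have w1' : normc w <= 1 by rewrite w1.
  have := GS w w1' 0%N; rewrite S0 horner0 sub0r normc_opp expr0 divr1 => h.
  have := normcD ((S n).[w] - G w) (G w); rewrite subrK => h'.
  have := GS w w1' n => h2.
  have : 4 * C / 2 ^+ n <= 4 * C.
    by rewrite ler_pdivrMr ?exprn_gt0// ler_peMr ?mulr_ge0// exprn_ege1// ler1n.
  by move: h h' h2; lra.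
pose r := (1 + normc z) / 2.
have r1 : r < 1 by rewrite /r; lra.
have zr : normc z <= r by rewrite /r; lra.
have [||D DP] := half_pow_limc (2 * C / (1 - r) ^+ 3) (fun n => (S n)^`().[z]).
- apply: divr_ge0; first exact: mulr_ge0.
  by apply: exprn_ge0; rewrite subr_ge0 ltW.
- move=> n; rewrite -hornerN -hornerD -derivB.
  rewrite [leRHS](_ : _ = 2 * (C / 2 ^+ n) / (1 - r) ^+ 3); last by ring.
  apply: poly_deriv_bound => // w w1; rewrite hornerD hornerN SC// w1//.
apply: (@derivable_quadratic _ _ D (4 * (8 * C) / (1 - r) ^+ 5) (1 - r)).
  by rewrite subr_gt0.
move=> w wz.
have wr : normc w <= r.
  by have := normcD (w - z) z; rewrite subrK; move: wz; rewrite /r; lra.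
(* The constant collects the errors that vanish as [n] grows: [S n] against [G] at [z] and [w], and
   the derivative of [S n] against [D]. *)
apply: (@le_half_pow _ _ (8 * C + normc (w - z) * (4 * (2 * C / (1 - r) ^+
  3)))) => n.
have w1 : normc w <= 1 by rewrite (le_trans wr) ?ltW.
have := @poly_taylor2_bound _ (S n) _ _ z w (S_bound n) r1 zr wr.
have := GS w w1 n; have := GS z (ltW z1) n; have := DP n.
set Kr := 4 * (8 * C) / _; set T := _ - _ - _ * _.[z]; move=> h1 h2 h3 h4.
have -> : G w - G z - (w - z) * D =
    T - ((S n).[w] - G w) + ((S n).[z] - G z) + (w - z) * ((S n)^`().[z] - D).
  by rewrite /T; ring.
rewrite (le_trans (normcD _ _))// normcM.
have h5 := normcD (T - ((S n).[w] - G w)) ((S n).[z] - G z).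
have h6 := normcB T ((S n).[w] - G w).
have h7 := ler_wpM2l (normc_ge0 (w - z)) h1.
rewrite mulrDl; move: h2 h3 h4 h5 h6 h7; lra.
Qed.

End limits_of_polynomials.

(** * Uniform continuity and truncated Poisson kernels *)

Section fejer_poisson.
Context {R : realType}.
Implicit Types (z w s : R[i]).

Lemma uniformly_continuous_itv (f : R -> R) (a b e : R) :
  continuous f -> 0 < e ->
  exists2 d, 0 < d & forall x y, a <= x <= b -> `|y - x| < d ->
    `|f y - f x| < e.
Proof.
move=> cf e0; have /compact_near_coveringP := @segment_compact R a b.
move=> /(_ _ (0 : R)^'+ (fun d x => forall y, `|y - x| < d ->
  `|f y - f x| < e)).
move=> /(_ _) [] //=.
  move=> x _; have /cvgrPdist_lt/(_ (e / 2)) := cf x.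
  rewrite divr_gt0// => /(_ isT)/nbhs_ballP[d /= d0 df].
  near=> u t => y /= yu.
  have ux : `|x - u| < d / 2 by near: u; apply: nbhsx_ballx; rewrite divr_gt0.
  have td : t < d / 2 by near: t; apply: nbhs_right_lt; rewrite divr_gt0.
  have hu : `|f x - f u| < e / 2 by apply: df; rewrite /ball /=; lra.
  have hy : `|f x - f y| < e / 2.
    apply: df; rewrite /ball /=.
    by rewrite -(subrKA u) (le_lt_trans (ler_normD _ _))// [`|u - y|]distrC;
      lra.
  by rewrite -(subrKA (f x)) (le_lt_trans (ler_normD _ _))//
    [`|f y - _|]distrC; lra.
move=> d /= d0 hd; exists (d / 2); first by rewrite divr_gt0.
have d2 : 0 < d / 2 by rewrite divr_gt0.
have h1 : `|0 - d / 2| < d by rewrite sub0r normrN gtr0_norm//; lra.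
move=> x y xab yx; have xi : `[a, b]%classic x by rewrite /= in_itv.
exact: (hd (d / 2) h1 d2 x xi y yx).
Unshelve. all: by end_near. Qed.

Lemma expr_small (r e : R) : 0 <= r < 1 -> 0 < e ->
  exists2 n, (0 < n)%N & r ^+ n < e.
Proof.
move=> /andP[r0 r1] e0.
have /cvg_expr/cvgrPdist_lt/(_ e e0) : `|r| < 1 by rewrite ger0_norm.
move=> [n _ /(_ (maxn n 1))] /=; rewrite leq_maxl => /(_ isT).
rewrite sub0r normrN ger0_norm ?exprn_ge0// => h.
by exists (maxn n 1); rewrite ?leq_max ?orbT.
Qed.

Definition poisson_poly (r : R) N : {poly R[i]} :=
  2%:P * (\poly_(k < N) (r ^+ k)%:C%C) - 1.

Lemma poisson_polyE r N s :
  (poisson_poly r N).[s] = 2 * \sum_(k < N) (r%:C%C * s) ^+ k - 1.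
Proof.
rewrite /poisson_poly hornerD hornerN hornerM !hornerC horner_poly.
by congr (_ * _ - _); apply: eq_bigr => k _; rewrite exprMn rmorphXn.
Qed.

(* [(1 - |r s|^2) / |1 - r s|^2] is the Poisson kernel
   [Re ((1 + r s) / (1 - r s))], of which [poisson_poly] is a truncation. *)
Lemma poisson_poly_approx r N s : 0 <= r < 1 -> normc s <= 1 ->
  `|Re (poisson_poly r N).[s] -
    (1 - (r * normc s) ^+ 2) / normc (1 - r%:C%C * s) ^+ 2| <=
  2 * r ^+ N / (1 - r).
Proof.
move=> /andP[r0 r1] s1; set u := (r%:C)%C * s.
have un : normc u = r * normc s by rewrite normcM normc_real ger0_norm.
have ur : normc u <= r by rewrite un ler_piMr.
have d0 : 1 - r <= normc (1 - u).
  by have := normcD (1 - u) u; rewrite subrK normc1; lra.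
have d1 : 0 < normc (1 - u) by apply: lt_le_trans d0; rewrite subr_gt0.
have u1 : 1 - u != 0.
  by apply/eqP => e; move: d1; rewrite e normc0 ltxx.
have -> : (poisson_poly r N).[s] = (1 + u) / (1 - u) - 2 * u ^+ N / (1 - u).
  rewrite poisson_polyE -/u; have := subrX1 u N; set S := \sum_(_ < _) _ => h.
  have -> : u ^+ N = (u - 1) * S + 1 by rewrite -h subrK.
  by field.
have ReE : Re ((1 + u) / (1 - u)) = (1 - normc u ^+ 2) / normc (1 - u) ^+ 2.
  have : Re (1 - u) ^+ 2 + Im (1 - u) ^+ 2 != 0.
    by rewrite -normc_sqr expf_eq0 /= gt_eqF.
  by rewrite !normc_sqr; case: (u) => a b /=; rewrite sub0r add0r => n0; field.
rewrite ReB ReE -un addrAC subrr sub0r normrN (le_trans (Re_le_normc _))//.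
rewrite !normcM normcV normcX normc_nat.
rewrite ler_pM ?mulr_ge0 ?invr_ge0 ?exprn_ge0 ?normc_ge0//.
  by rewrite ler_pM2l// lerXn2r ?nnegrE ?normc_ge0.
by rewrite lef_pV2 ?posrE// subr_gt0.
Qed.

Lemma cisN (t : R) : cis (- t) * cis t = 1.
Proof. by rewrite -cisD addNr cis0. Qed.

(** With as many nodes as terms in the truncation, every power 0 < k < N averages to 0 over the
    roots of unity. The rotated kernels thus have mean exactly 1, with no quadrature error. *)
Lemma sum_poisson_poly r N s : (0 < N)%N ->
  \sum_(j < N) (poisson_poly r N).[cis (- (2 * pi / N%:R * j%:R)) * s] = N%:R.
Proof.
move=> N0.
(* The inverse of the root of unity is its power [N.-1], which keeps all exponents natural. *)
have cE (j : 'I_N) : cis (- (2 * pi / N%:R * j%:R)) =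
    (cis (2 * pi / N%:R) ^+ N.-1) ^+ j :> R[i].
  have unit_cis (t : R) : cis t != 0.
    by apply/eqP => /(congr1 (@normc _)) /eqP;
      rewrite normc_cis normc0 oner_eq0.
  apply: (mulIf (unit_cis (2 * pi / N%:R * j%:R))); rewrite cisN.
  rewrite (mulrC _ j%:R) -cisX -exprMn -exprSr prednK//.
  by rewrite (prim_expr_order (cis_unity_prim _ N0)) expr1n.
under eq_bigr => j _ do rewrite poisson_polyE cE.
rewrite big_split /= sumr_const card_ord -mulr_sumr exchange_big /=.
have -> : \sum_(k < N) \sum_(j < N)
    (r%:C%C * ((cis (2 * pi / N%:R) ^+ N.-1) ^+ j * s)) ^+ k = N%:R.
  rewrite (bigD1 (Ordinal N0)) //= [X in _ + X]big1 => [|k k0].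
    by rewrite addr0 (eq_bigr (fun=> 1))// sumr_const card_ord.
  rewrite (eq_bigr (fun j : 'I_N => (r%:C%C * s) ^+ k *
      (cis (2 * pi / N%:R) ^+ (N.-1 * k)) ^+ j)); last first.
    move=> j _; rewrite mulrCA exprMn mulrC; congr (_ * _).
    by rewrite -!exprM mulnAC.
  rewrite -mulr_sumr sum_unity_roots// ifF ?mulr0//; apply/negbTE.
  rewrite Gauss_dvdr; last by rewrite coprime_sym coprimePn.
  by rewrite gtnNdvd// lt0n.
by rewrite mulNrn; ring.
Qed.

End fejer_poisson.

(** * Approximation of continuous functions by real parts of polynomials *)

Section approximation.
Context {R : realType}.
Implicit Types (z w s : R[i]).

Lemma cos_le_away (d x : R) : 0 <= d <= pi -> d <= `|x| <= 2 * pi - d ->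
  cos x <= cos d.
Proof.
move=> /andP[d0 dpi] /andP[dx xd]; rewrite -cos_norm.
have [xpi|xpi] := leP `|x| pi.
  by rewrite leNgt ltr_cos ?in_itv/= ?normr_ge0 ?d0 ?dpi// -leNgt.
rewrite -cosN -(cosD2pi (- `|x|)) leNgt ltr_cos ?in_itv/= -?leNgt ?d0 ?dpi//.
  by rewrite -mulr_natl; lra.
by rewrite -mulr_natl; apply/andP; split; lra.
Qed.

(** The Poisson kernel is nonnegative, so its truncation is negative by at most the truncation
    error. Sums of absolute values thereby reduce to sums that are known exactly. *)
Lemma poisson_poly_norm (r : R) N s : 0 <= r < 1 -> normc s <= 1 ->
  `|Re (poisson_poly r N).[s]| <=
  Re (poisson_poly r N).[s] + 2 * (2 * r ^+ N / (1 - r)).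
Proof.
move=> r01 s1; have := poisson_poly_approx r N s r01 s1.
case/andP: r01 => r0 r1; set p := _ / _ ^+ 2; set t := 2 * _ / _.
have p0 : 0 <= p.
  rewrite /p divr_ge0 ?exprn_ge0 ?normc_ge0//
    subr_ge0 expr_le1 ?mulr_ge0 ?normc_ge0//.
  by rewrite mulr_ile1 ?normc_ge0// ltW.
have t0 : 0 <= t by rewrite /t divr_ge0 ?mulr_ge0 ?exprn_ge0// subr_ge0 ltW.
rewrite ler_norml => /andP[h1 h2]; rewrite ler_norml; apply/andP; split; lra.
Qed.

(** Here |1 - r e^(it)|^2 = (1 - r)^2 + 2 r (1 - cos t) is at least 2 r c >= c, while the numerator
    1 - r^2 is at most 2 (1 - r). *)
Lemma poisson_poly_cis_small (r c t : R) N : 2^-1 <= r < 1 -> 0 < c ->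
  cos t <= 1 - c ->
  `|Re (poisson_poly r N).[cis t]| <= 2 * (1 - r) / c + 2 * r ^+ N / (1 - r).
Proof.
move=> /andP[r2 r1] c0 tc; have r0 : 0 <= r by rewrite (le_trans _ r2).
have r01 : 0 <= r < 1 by rewrite r0.
have := poisson_poly_approx r N (cis t) r01; rewrite normc_cis lexx mulr1.
move=> /(_ isT) h; have := ler_normD (Re (poisson_poly r N).[cis t] -
  (1 - r ^+ 2) / normc (1 - r%:C%C * cis t) ^+ 2)
  ((1 - r ^+ 2) / normc (1 - r%:C%C * cis t) ^+ 2).
rewrite subrK => /le_trans; apply; rewrite addrC lerD//.
have den : c <= normc (1 - r%:C%C * cis t) ^+ 2.
  rewrite normc_sqr /=.
  have -> : (1 - (r * cos t - 0 * sin t)) ^+ 2 + (0 - (r * sin t + 0 * cos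
    t)) ^+ 2 =
    1 - 2 * r * cos t + r ^+ 2 * (cos t ^+ 2 + sin t ^+ 2) by ring.
  by rewrite cos2Dsin2; nra.
rewrite ger0_norm; last first.
  by rewrite divr_ge0 ?exprn_ge0 ?normc_ge0// subr_ge0 expr_le1// ltW.
rewrite ler_pM ?invr_ge0 ?exprn_ge0 ?normc_ge0//; [|nra|].
  by rewrite subr_ge0 expr_le1// ltW.
by rewrite lef_pV2 ?posrE// (lt_le_trans c0).
Qed.

Lemma poisson_poly0 (r : R) N : (0 < N)%N -> (poisson_poly r N).[0] = 1.
Proof.
case: N => // N _; rewrite poisson_polyE mulr0 big_ord_recl expr0 big1 ?addr0.
  by rewrite mulr1 -[2]/(1 + 1) addrK.
by move=> i _; rewrite expr0n.
Qed.

(** [P] averages the rotated kernels with weights [f (n j)]. Uniform continuity handles the nodes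
    near [t], the decay of the kernel the others. The ends of the period are cut off because [f] may
    take different values at 0 and 2 pi. *)
Lemma harmonic_approximation (f : R -> R) (e d : R) :
  continuous f -> (forall t, `|f t| <= 1) -> 0 < e -> 0 < d ->
  exists P : {poly R[i]}, [/\ Im P.[0] = 0,
    forall z, normc z <= 1 -> `|Re P.[z]| <= 2 &
    forall t, d <= t <= 2 * pi - d -> `|f t - Re P.[cis t]| <= e].
Proof.
move=> cf f1 e0 d0; have pi0 := @pi_gt0 R.
have e40 : 0 < e / 4 by rewrite divr_gt0.
have [d1 d10 fd1] := uniformly_continuous_itv f 0 (2 * pi) (e / 4) cf e40.
(* [a <= d1] makes the decay available at far nodes, [a <= d] keeps them away from [u] across the
   ends of the period too, and the bound pi / 2 gives cos a < 1. *)
pose a := Num.min (Num.min d d1) (pi / 2).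
have a0 : 0 < a by rewrite !lt_min d0 d10 divr_gt0.
have ad : a <= d by rewrite !ge_min lexx.
have ad1 : a <= d1 by rewrite !ge_min lexx orbT.
have api : a <= pi / 2 by rewrite !ge_min lexx orbT.
pose c := 1 - cos a.
have c0 : 0 < c.
  rewrite subr_gt0 lt_neqAle cos_le1 cos_neq1//; apply/andP; split => //; lra.
(* [x] is 1 - r; the second bound makes 2 (1 - r) / c at most e / 8. *)
pose x := Num.min (2^-1) (e * c / 16).
have x0 : 0 < x by rewrite lt_min invr_gt0 ltr0n divr_gt0// mulr_gt0.
have x2 : x <= 2^-1 by rewrite ge_min lexx.
have xe : x <= e * c / 16 by rewrite ge_min lexx orbT.
pose r := 1 - x.
have r01 : 0 <= r < 1 by rewrite /r; clear -x0 x2; apply/andP; split; lra.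
have r2 : 2^-1 <= r < 1 by rewrite /r; clear -x0 x2; apply/andP; split; lra.
(* Chosen so that the truncation error [t] is below both 1/4 and e / 8. *)
pose y := Num.min (4^-1) (e / 8) * x / 2.
have y0 : 0 < y by rewrite divr_gt0// mulr_gt0// lt_min invr_gt0 ltr0n divr_gt0.
have [N N0 rN] := expr_small r y r01 y0.
pose t := 2 * r ^+ N / (1 - r).
have tE : t < Num.min (4^-1) (e / 8).
  by rewrite /t ltr_pdivrMr /r; [move: rN; rewrite /y; lra|lra].
have [t4 te] : t <= 4^-1 /\ t <= e / 8.
  by move: tE; rewrite lt_min => /andP[/ltW ? /ltW ?].
have t0 : 0 <= t.
  by case/andP: r01 => r0 r1;
    rewrite /t divr_ge0 ?mulr_ge0 ?exprn_ge0// subr_ge0 ltW.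
have N0' : 0 < N%:R :> R by rewrite ltr0n.
pose n j : R := 2 * pi / N%:R * j%:R.
pose k (j : nat) z := Re (poisson_poly r N).[cis (- n j) * z].
pose P : {poly R[i]} := \sum_(j < N) ((f (n j) / N%:R)%:C)%C%:P *
  (poisson_poly r N \Po ((cis (- n j))%:P * 'X)).
have PE z : Re P.[z] = N%:R^-1 * \sum_(j < N) f (n j) * k j z.
  rewrite /P horner_sum Re_sum mulr_sumr; apply: eq_bigr => j _.
  rewrite hornerM hornerC horner_comp hornerM hornerC hornerX Re_mul Re_real
    Im_real.
  by rewrite mul0r subr0 mulrA [_^-1 * _]mulrC.
have kE z : \sum_(j < N) k j z = N%:R.
  rewrite -Re_sum sum_poisson_poly//.
  by rewrite -[N%:R in LHS](rmorph_nat (real_complex R)).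
have kn (j : nat) z : normc z <= 1 -> `|k j z| <= k j z + 2 * t.
  by move=> z1; apply: poisson_poly_norm => //; rewrite normcM normc_cis mul1r.
have sum_kn z : \sum_(j < N) (k j z + 2 * t) = N%:R * (1 + 2 * t).
  by rewrite big_split /= kE sumr_const card_ord -mulr_natl; ring.
exists P; split.
- rewrite /P horner_sum Im_sum big1// => j _.
  rewrite hornerM hornerC horner_comp hornerM hornerC hornerX mulr0.
  by rewrite poisson_poly0// mulr1 Im_real.
- move=> z z1; rewrite PE normrM ger0_norm ?invr_ge0 ?ler0n// ler_pdivrMl//.
  rewrite (le_trans (ler_norm_sum _ _ _))//.
  apply: (@le_trans _ _ (\sum_(j < N) (k j z + 2 * t))).
    apply: ler_sum => j _; rewrite normrM (le_trans _ (kn j z z1))//.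
    by rewrite ler_piMl// f1.
  by rewrite sum_kn ler_pM2l//; lra.
move=> u /andP[du ud].
have u1 : normc (cis u) <= 1 by rewrite normc_cis.
(* The weights sum to [N], so [f u] is its own weighted mean. *)
have -> : f u - Re P.[cis u] = N%:R^-1 * \sum_(j < N) (f u - f (n j)) * k j
  (cis u).
  under eq_bigr => j _ do rewrite mulrBl.
  rewrite sumrB -mulr_sumr kE PE mulrBr; congr (_ - _).
  by rewrite mulrCA mulVf ?mulr1// gt_eqF.
rewrite normrM ger0_norm ?invr_ge0 ?ler0n// ler_pdivrMl//.
rewrite (le_trans (ler_norm_sum _ _ _))//.
(* Each term is bounded by the near estimate plus the far one, both nonnegative, so the sum is never
   split. *)
apply: (@le_trans _ _ (\sum_(j < N) ((e / 4) * (k j (cis u) + 2 * t) + 2 * (2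
  * (1 - r) / c + t)))).
  apply: ler_sum => j _; rewrite normrM.
  have n0 : 0 <= n j by rewrite /n mulr_ge0// divr_ge0// mulr_ge0// ltW.
  have n2 : n j <= 2 * pi.
    rewrite /n mulrAC ler_pdivrMr// ler_pM2l ?mulr_gt0// ler_nat.
    by rewrite ltnW.
  have kn0 := kn j (cis u) u1; have kge := normr_ge0 (k j (cis u)).
  have sge : 0 <= 2 * (1 - r) / c by rewrite divr_ge0 ?(ltW c0)//
    mulr_ge0// /r; clear -x0; lra.
  have [close|far] := ltP `|n j - u| d1.
    have hu : 0 <= u <= 2 * pi by clear -du ud d0; apply/andP; split; lra.
    have := fd1 u (n j) hu close; rewrite distrC => h.
    have h1 : `|f u - f (n j)| * `|k j (cis u)| <= e / 4 * (k j (cis u) + 2 *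
      t).
      by rewrite ler_pM// ltW.
    by clear -h1 sge t0; lra.
  have kE' : k j (cis u) = Re (poisson_poly r N).[cis (u - n j)].
    by rewrite /k -cisD addrC.
  have : `|k j (cis u)| <= 2 * (1 - r) / c + t.
    rewrite kE'; apply: poisson_poly_cis_small => //.
    rewrite /c subKr; apply: cos_le_away; first by clear -a0 api pi0;
      apply/andP; split; lra.
    rewrite distrC in far; rewrite (le_trans ad1 far) /= ler_norml.
    by clear -du ud n0 n2 ad a0; apply/andP; split; lra.
  have : `|f u - f (n j)| <= 2.
    by have := ler_normB (f u) (f (n j)); have := f1 u; have := f1 (n j);
      clear; lra.
  move=> h1 h2; have h3 : `|f u - f (n j)| * `|k j (cis u)| <= 2 * (2 * (1 -
    r) / c + t).
    by rewrite ler_pM.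
  have : 0 <= e / 4 * (k j (cis u) + 2 * t) by apply: mulr_ge0;
    [exact: ltW|exact: le_trans kge kn0].
  by clear -h3; lra.
rewrite big_split /= -mulr_sumr sum_kn sumr_const card_ord -[X in _ +
  X]mulr_natl.
have xc : 2 * (1 - r) / c <= e / 8.
  by rewrite /r subKr ler_pdivrMr//; lra.
have : e / 4 * (1 + 2 * t) + 2 * (2 * (1 - r) / c + t) <= e by nra.
move=> h; rewrite -(ler_pM2l N0') in h; apply: le_trans h.
by rewrite le_eqVlt; apply/orP; left; apply/eqP; ring.
Qed.

End approximation.

(** * Mean values over the circle and the size of the imaginary part *)

Section conjugate_estimate.
Context {R : realType}.
Implicit Types (p q : {poly R[i]}).

Lemma continuous_poly_cis q :
  continuous (fun t : R => Re q.[cis t]) /\ continuous (fun t : R => Im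
    q.[cis t]).
Proof.
elim/poly_ind: q => [|q c [cRe cIm]].
  by split => t; under eq_fun do rewrite horner0; exact: cvg_cst.
have cc := @continuous_cos R; have cs := @continuous_sin R.
split => t.
  rewrite (_ : (fun t => _) = (fun t => Re q.[cis t] * cos t - Im q.[cis t] *
    sin t + Re c)).
    by apply: cvgD; [apply: cvgB; apply: cvgM;
      [exact: cRe|exact: cc|exact: cIm|exact: cs]|exact: cvg_cst].
  by apply/funext => u; rewrite hornerMXaddC ReD Re_mul.
rewrite (_ : (fun t => _) = (fun t => Re q.[cis t] * sin t + Im q.[cis t] *
  cos t + Im c)).
  by apply: cvgD; [apply: cvgD; apply: cvgM;
    [exact: cRe|exact: cs|exact: cIm|exact: cc]|exact: cvg_cst].
by apply/funext => u; rewrite hornerMXaddC ImD Im_mul.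
Qed.

(** As 0^0 = 1, subtracting [c * 0 ^+ n] removes exactly the constant term, the only one whose
    primitive would change over a period. *)
Lemma trig_monomial_primitive (c : R[i]) n : exists F : R -> R,
  (forall t : R, is_derive t 1 F (Re (c * cis t ^+ n) - Re (c * 0 ^+ n))) /\
  F (2 * pi) = F 0.
Proof.
case: n => [|n].
  exists (fun=> 0); split => // t; rewrite !expr0 subrr; exact: is_derive_cst.
exists (fun t => n.+1%:R^-1 * (Re c * sin (n.+1%:R * t) + Im c * cos (n.+1%:R
  * t))).
split; last first.
  have := cisX (2 * pi : R) n.+1; rewrite cis2pi expr1n => -[<- <-].
  by rewrite !mulr0 sin0 cos0 mulr0.
move=> t; rewrite expr0n mulr0 subr0 cisX Re_mul /=.
have dl : is_derive t 1 (fun t : R => n.+1%:R * t) n.+1%:R.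
  apply: (is_derive_eq (is_deriveZ n.+1%:R (is_derive_id t 1))).
  by rewrite /GRing.scale /= mulr1.
have ds : is_derive t 1 (fun t : R => sin (n.+1%:R * t)) (cos (n.+1%:R * t) *
  n.+1%:R).
  exact: (is_derive1_comp (f := sin) (g := fun t => n.+1%:R * t)).
have dc : is_derive t 1 (fun t : R => cos (n.+1%:R * t)) (- sin (n.+1%:R * t)
  * n.+1%:R).
  exact: (is_derive1_comp (f := cos) (g := fun t => n.+1%:R * t)).
apply: (is_derive_eq (is_deriveZ n.+1%:R^-1
  (is_deriveD (is_deriveZ (Re c) ds) (is_deriveZ (Im c) dc)))).
by rewrite /GRing.scale /=; field; rewrite addrC natr1 pnatr_eq0.
Qed.

Lemma trig_poly_primitive q : exists F : R -> R,
  (forall t : R, is_derive t 1 F (Re q.[cis t] - Re q.[0])) /\ F (2 * pi) = F 0.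
Proof.
have [F FP] := choice (fun i : 'I_(size q) => trig_monomial_primitive q`_i i).
exists (\sum_(i < size q) F i); split.
  move=> t; rewrite !horner_coef !Re_sum -sumrB; apply: is_derive_sum => i.
  exact: (FP i).1.
by rewrite !fct_sumE; apply: eq_bigr => i _; rewrite (FP i).2.
Qed.

Lemma integral_Re_poly q (b : R) : (forall t, Re q.[cis t] <= b) ->
  (\int[lebesgue_measure]_(t in `[0%R, (2 * pi)%R]) (b - Re q.[cis t])%:E =
   (2 * pi * (b - Re q.[0]))%R%:E)%E.
Proof.
move=> qb; have [F [dF FE]] := trig_poly_primitive q.
pose G : R -> R := fun t => (b - Re q.[0]) * t - F t.
have dG (t : R) : is_derive t 1 G (b - Re q.[cis t]).
  apply: (is_derive_eq (is_deriveB (is_deriveZ (b - Re q.[0]) (is_derive_id t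
    1)) (dF t))).
  by rewrite /GRing.scale /=; ring.
rewrite (@continuous_FTC2 _ _ G).
- by rewrite -EFinB /G FE; congr EFin; ring.
- by rewrite mulr_gt0// pi_gt0.
- apply: continuous_subspaceT => t; apply: cvgB; first exact: cvg_cst.
  exact: (continuous_poly_cis q).1.
- have cG : continuous G.
    by move=> t; apply: differentiable_continuous; apply/derivable1_diffP;
      case: (dG t).
  split.
  + by move=> t _; case: (dG t).
  + exact/cvg_at_right_filter/cG.
  + exact/cvg_at_left_filter/cG.
- by move=> t _; rewrite derive1E; have [_ ->] := dG t.
Qed.

(** Chebyshev's inequality for (Im p)^2 = (Re p)^2 - Re (p^2) <= 4 - Re (p^2): as p(0) is real, the
    right side has mean 4 - p(0)^2 <= 4, hence integral at most 8 pi. *)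
Lemma conjugate_measure p (a : R) : Im p.[0] = 0 -> 0 < a ->
  (forall t : R, `|Re p.[cis t]| <= 2) ->
  (lebesgue_measure ([set` `[0%R,
    (2 * pi)%R]] `&` [set t : R | (a < Im p.[cis t] ^+ 2)%R])
    <= (8 * pi / a)%:E)%E /\
  measurable ([set` `[0%R, (2 * pi)%R]] `&` [set t : R | (a < Im p.[cis t] ^+
    2)%R]).
Proof.
move=> p0 a0 p2; set D := [set` _]; set S := _ `&` _.
have cI := (continuous_poly_cis p).2;
  have cR := (continuous_poly_cis (p ^+ 2)).1.
have mS : measurable S.
  apply: measurableI; [exact: measurable_itv|apply: open_measurable].
  apply: (@open_comp _ _ (fun t : R => Im p.[cis t] ^+ 2) [set x | a < x]).
    move=> t _; rewrite /continuous_at expr2; under eq_fun do rewrite expr2;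
      apply: cvgM; exact: cI.
  exact: open_gt.
split => //.
have v2 t : Im p.[cis t] ^+ 2 <= 4 - Re (p ^+ 2).[cis t].
  have := p2 t; rewrite ler_norml => /andP[h1 h2].
  by rewrite horner_exp expr2 [X in Re X]expr2 Re_mul; nra.
rewrite EFinM lee_pdivlMr//.
have intE := @integral_Re_poly (p ^+ 2) 4.
apply: (@le_trans _ _ (\int[lebesgue_measure]_(t in S) a%:E))%E.
  by rewrite integral_cst// muleC.
have mf : measurable_fun setT (fun t => (4 - Re (p ^+ 2).[cis t])%:E).
  apply/measurable_EFinP; apply: continuous_measurable_fun => t.
  by apply: cvgB; [exact: cvg_cst|exact: cR].
apply: (@le_trans _ _ (\int[lebesgue_measure]_(t in S) (4 - Re (p ^+ 2).[cis
  t])%:E))%E.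
  apply: ge0_le_integral => //.
  - by move=> t _; rewrite lee_fin ltW.
  - exact: measurable_funTS.
  - by move=> t [_ /= h]; rewrite lee_fin (le_trans (ltW h)).
apply: (@le_trans _ _ (\int[lebesgue_measure]_(t in D) (4 - Re (p ^+ 2).[cis
  t])%:E))%E.
  apply: ge0_subset_integral => //; first exact: measurable_itv.
  - exact: measurable_funTS.
  - by move=> t _; rewrite lee_fin (le_trans _ (v2 t))// sqr_ge0.
  - exact: subIsetl.
rewrite intE; last by move=> t; rewrite -subr_ge0 (le_trans _ (v2 t))// sqr_ge0.
rewrite lee_fin horner_exp expr2 Re_mul p0 mul0r subr0.
have : 0 <= pi * (Re p.[0] * Re p.[0]) by rewrite mulr_ge0 ?pi_ge0//
  -expr2 sqr_ge0.
lra.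
Qed.

End conjugate_estimate.

(** * One bounded correction step *)

Section bounded_correction.
Context {R : realType}.
Implicit Types (p q : {poly R[i]}) (z : R[i]).

Lemma poly_bounded_disk q : exists2 Y : R, 0 <= Y &
  forall z, normc z <= 1 -> normc q.[z] <= Y.
Proof.
exists (\sum_(i < size q) normc q`_i); first by rewrite sumr_ge0// => i _;
  exact: normc_ge0.
move=> z z1; rewrite horner_coef (le_trans (normc_sum _ _ _ _))//.
apply: ler_sum => i _; rewrite normcM normcX ler_piMr ?normc_ge0//.
by rewrite exprn_ile1 ?normc_ge0.
Qed.

(** Put phi(w) = lam w / (lam - w). On the strip [w] is at least as close to 0 as to [lam], so |phi|
    <= lam; and phi(w) - w = w^2 / (lam - w), where |w|^2 <= 4 + (Im w)^2. The factor 2 and the term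
    1/16 pay for truncating the series. *)
Lemma moebius_approximation p (lam : R) : 4 <= lam ->
  (forall z, normc z <= 1 -> `|Re p.[z]| <= 2) ->
  exists q : {poly R[i]}, forall z, normc z <= 1 ->
    normc q.[z] <= 2 * lam /\
    normc (q.[z] - p.[z]) <= (4 + Im p.[z] ^+ 2) / (lam - 2) + 16^-1.
Proof.
move=> lam4 p2; have [Y Y0 pY] := poly_bounded_disk p.
have lam0 : 0 < lam by rewrite (lt_le_trans _ lam4).
(* [|P + L|^2 <= Y^2 + 4 L + L^2 < (lam + L)^2] on the strip, so the geometric
   series of [1 / (lam - P)] around [- L] converges uniformly. *)
pose L := Y ^+ 2 + 1.
have L0 : 0 < L by rewrite ltr_wpDl// sqr_ge0.
have lL : 0 < lam + L by rewrite addr_gt0.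
pose x := Num.sqrt (5 * L + L ^+ 2) / (lam + L).
have x0 : 0 <= x by rewrite divr_ge0 ?sqrtr_ge0// ltW.
have x1 : x < 1.
  rewrite /x ltr_pdivrMr// mul1r -(ger0_norm (ltW lL)) -sqrtr_sqr ltr_sqrt
    ?exprn_gt0//.
  by clear -lam4 L0; nra.
have x01 : 0 <= x < 1 by rewrite x0.
have e0 : 0 < 16^-1 / lam by rewrite divr_gt0// invr_gt0.
(* [x] will bound the ratio [S] of the series, so the discarded tail is at most lam x^m <= 1/16. *)
have [m _ xm] := expr_small x _ x01 e0.
have {}xm : lam * x ^+ m <= 16^-1.
  by rewrite ltW// mulrC -ltr_pdivlMr.
pose c : R[i] := ((lam + L)^-1)%:C%C.
pose S : {poly R[i]} := c%:P * (p + (L%:C)%C%:P).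
(* Since 1 - S = c (lam - P), this polynomial equals phi(P) (1 - S^m). *)
exists ((lam%:C)%C%:P * c%:P * p * \sum_(k < m) S ^+ k) => z z1.
rewrite !hornerM !hornerC horner_sum.
under eq_bigr => k _ do rewrite horner_exp hornerM hornerD !hornerC.
have p2z := p2 z z1; have pYz := pY z z1.
move: p2z pYz; move: p.[z] => w w2 wY.
set s := c * (w + _).
have sx : normc s <= x.
  rewrite /s /c /x normcM normc_real ger0_norm ?invr_ge0 ?(ltW lL)// mulrC.
  rewrite ler_pM2r ?invr_gt0// -[leLHS]ger0_norm ?normc_ge0// -sqrtr_sqr.
  rewrite ler_sqrt; last by rewrite addr_ge0 ?sqr_ge0// mulr_ge0// ltW.
  have h : normc w ^+ 2 <= Y ^+ 2 by rewrite lerXn2r ?nnegrE ?normc_ge0.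
  rewrite normc_sqr ReD ImD Re_real Im_real addr0.
  move: h w2; rewrite normc_sqr ler_norml => h /andP[_ w2].
  by rewrite /L in L0 *; move: h w2 L0; clear; nra.
have wlam : normc w <= normc ((lam%:C)%C - w).
  rewrite -(ler_pXn2r (n := 2))// ?nnegrE ?normc_ge0//
    !normc_sqr ReB ImB Re_real Im_real.
  by move: w2 lam4; clear; rewrite ler_norml => /andP[h1 h2] h3; nra.
have lamw : lam - 2 <= normc ((lam%:C)%C - w).
  apply: le_trans (Re_le_normc _); rewrite ReB Re_real.
  apply: le_trans (ler_norm _); move: w2; clear.
  by rewrite ler_norml => /andP[h1 h2]; lra.
have lam2 : 0 < lam - 2 by clear -lam4; lra.
have dn0 : (lam%:C)%C - w != 0.
  apply/eqP => e; move: lamw; rewrite e normc0; clear -lam2; lra.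
have lLc : c^-1 = (lam%:C)%C + (L%:C)%C.
  by rewrite /c -fmorphV invrK rmorphD.
have cn0 : c != 0 by rewrite -invr_eq0 lLc -rmorphD fmorph_eq0 gt_eqF.
have QE : (lam%:C)%C * c * w * \sum_(k < m) s ^+ k =
    (lam%:C)%C * w / ((lam%:C)%C - w) * (1 - s ^+ m).
  have h := subrX1 s m.
  have s1 : s - 1 = - (c * ((lam%:C)%C - w)).
    rewrite /s -[in LHS](mulfV cn0) lLc; ring.
  have -> : 1 - s ^+ m = - (s ^+ m - 1) by rewrite opprB.
  have lLn : (lam%:C)%C + (L%:C)%C != 0 by rewrite -lLc invr_eq0.
  by rewrite h s1; field; rewrite lLn dn0.
have phi_le : normc ((lam%:C)%C * w / ((lam%:C)%C - w)) <= lam.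
  rewrite !normcM normcV normc_real gtr0_norm// ler_pdivrMr; last first.
    exact: lt_le_trans lamw.
  by rewrite ler_pM2l.
have sm : normc (s ^+ m) <= x ^+ m by rewrite normcX lerXn2r ?nnegrE ?normc_ge0.
rewrite QE; split.
  rewrite normcM mulrC ler_pM ?normc_ge0//.
  rewrite (le_trans (normcB _ _))// normc1 -[2]/(1 + 1) lerD2l (le_trans sm)//.
  by rewrite exprn_ile1// ltW.
have -> : (lam%:C)%C * w / ((lam%:C)%C - w) * (1 - s ^+ m) - w =
    w ^+ 2 / ((lam%:C)%C - w) - (lam%:C)%C * w / ((lam%:C)%C - w) * s ^+ m.
  by field.
rewrite (le_trans (normcB _ _))// lerD//.
  rewrite normcM normcV normcX ler_pM ?invr_ge0 ?exprn_ge0 ?normc_ge0//.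
    rewrite normc_sqr lerD2r -[Re w ^+ 2]real_normK ?num_real//.
    by move: w2 (normr_ge0 (Re w)); clear; nra.
  by rewrite lef_pV2 ?posrE// (lt_le_trans lam2).
by rewrite normcM (le_trans _ xm)// ler_pM ?normc_ge0.
Qed.

(** The error 1/4 splits as 1/16 from the harmonic approximation, 1/8 from the Moebius map and 1/16
    from truncation. Where (Im p)^2 <= lam / 16, the middle bound amounts to [68 <= lam]. The bad
    set consists of two end intervals of length 1 / lam and a set of measure at most 128 pi /
    lam. *)
Lemma bounded_correction1 (f : R -> R) (lam : R) :
  68 <= lam -> continuous f -> (forall t, `|f t| <= 1) ->
  exists (q : {poly R[i]}) (B : set R),
    [/\ forall z, normc z <= 1 -> normc q.[z] <= 2 * lam,
        measurable B,
        (lebesgue_measure B <= ((2 + 128 * pi) / lam)%:E)%E &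
        forall t, 0 <= t <= 2 * pi -> ~ B t -> `|f t - Re q.[cis t]| <= 4^-1].
Proof.
move=> lam68 cf f1.
have lam0 : 0 < lam by rewrite (lt_le_trans _ lam68).
have [||p [p0 p2 pf]] := harmonic_approximation f 16^-1 lam^-1 cf f1 _ _.
- by rewrite invr_gt0.
- by rewrite invr_gt0.
have [|q qP] := moebius_approximation p lam _ p2.
  by clear -lam68; lra.
have p2' t : `|Re p.[cis t]| <= 2 by apply: p2; rewrite normc_cis.
have [|muS mS] := conjugate_measure p (lam / 16) p0 _ p2';
  first by rewrite divr_gt0.
move: muS mS; set S := _ `&` _ => muS mS.
pose B1 := `[0, lam^-1]%classic : set R.
pose B2 := `[2 * pi - lam^-1, 2 * pi]%classic : set R.
have mB1 : measurable B1 by exact: measurable_itv.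
have mB2 : measurable B2 by exact: measurable_itv.
exists q, (B1 `|` B2 `|` S); split.
- by move=> z z1; have [] := qP z z1.
- by apply: measurableU => //; apply: measurableU.
- have l1 : lebesgue_measure B1 = (lam^-1)%:E.
    by rewrite lebesgue_measure_itv/= lte_fin invr_gt0 lam0 sube0.
  have l2 : lebesgue_measure B2 = (lam^-1)%:E.
    rewrite lebesgue_measure_itv/= lte_fin gtrBl invr_gt0 lam0 -EFinB.
    by rewrite opprB addrC subrK.
  have h := measureU2 lebesgue_measure (measurableU _ _ mB1 mB2) mS.
  have h' := measureU2 lebesgue_measure mB1 mB2.
  rewrite (le_trans h)//.
  have -> : (2 + 128 * pi) / lam = (lam^-1 + lam^-1) + 8 * pi / (lam / 16).
    by field; rewrite gt_eqF.
  rewrite EFinD leeD//; apply: le_trans h' _.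
  rewrite EFinD leeD// le_eqVlt; apply/orP; left; apply/eqP;
    [exact: l1|exact: l2].
move=> t /andP[t0 t2] nB.
have ta : lam^-1 <= t.
  rewrite leNgt; apply/negP => h; apply: nB; left; left.
  by rewrite /B1 /= in_itv /= t0 ltW.
have tb : t <= 2 * pi - lam^-1.
  rewrite leNgt; apply/negP => h; apply: nB; left; right.
  by rewrite /B2 /= in_itv /= t2 ltW.
have ti : Im p.[cis t] ^+ 2 <= lam / 16.
  rewrite leNgt; apply/negP => h; apply: nB; right.
  by split => //=; rewrite in_itv /= t0 t2.
have /pf h1 : lam^-1 <= t <= 2 * pi - lam^-1 by rewrite ta tb.
have [|_ h2] := qP (cis t) _; first by rewrite normc_cis.
have h3 := le_trans (Re_le_normc _) h2; rewrite ReB in h3.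
have h4 : (4 + Im p.[cis t] ^+ 2) / (lam - 2) <= 8^-1.
  rewrite ler_pdivrMr; last by clear -lam68; lra.
  by move: ti lam68; clear; lra.
have := ler_normB (f t - Re p.[cis t]) (Re q.[cis t] - Re p.[cis t]).
rewrite opprB addrA subrK; move: h1 h3 h4; clear; lra.
Qed.

Lemma bounded_correction (f : R -> R) (M lam : R) :
  68 <= lam -> 0 < M -> continuous f -> (forall t, `|f t| <= M) ->
  exists (q : {poly R[i]}) (B : set R),
    [/\ forall z, normc z <= 1 -> normc q.[z] <= 2 * lam * M,
        measurable B,
        (lebesgue_measure B <= ((2 + 128 * pi) / lam)%:E)%E &
        forall t, 0 <= t <= 2 * pi -> ~ B t -> `|f t - Re q.[cis t]| <= M / 4].
Proof.
move=> lam68 M0 cf fM; have M1 : M != 0 by rewrite gt_eqF.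
have [||q [B [q1 mB muB qf]]] := bounded_correction1 (fun t => M^-1 * f t)
  lam lam68.
- by move=> t; apply: cvgM; [exact: cvg_cst|exact: cf].
- by move=> t; rewrite normrM normfV (gtr0_norm M0) ler_pdivrMl// mulr1.
exists ((M%:C)%C%:P * q), B; split => //.
- move=> z z1; rewrite hornerM hornerC normcM normc_real gtr0_norm// mulrC.
  by rewrite ler_pM2r// q1.
move=> t t2 nB; have := qf t t2 nB.
rewrite -(ler_pM2l M0) -{1}(gtr0_norm M0) -normrM mulrBr mulVKf//.
by rewrite hornerM hornerC Re_mul Re_real Im_real mul0r subr0.
Qed.

End bounded_correction.

(** * Iteration of the correction for a continuous function *)

Section continuous_case.
Context {R : realType}.
Implicit Types (q : {poly R[i]}) (z w : R[i]).

(** For c >= 0 this is truncation to [-c, c], in a form whose continuity is immediate. *)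
Definition clamp (c x : R) : R := (`|x + c| - `|x - c|) / 2.

Lemma clamp_le (c x : R) : 0 <= c -> `|clamp c x| <= c.
Proof.
move=> c0; rewrite /clamp normrM [`|2^-1|]gtr0_norm ?invr_gt0// ler_pdivrMr//.
have := ler_dist_dist (x + c) (x - c); move/le_trans; apply.
have -> : x + c - (x - c) = c * 2 by ring.
by rewrite ger0_norm// mulr_ge0.
Qed.

Lemma clamp_id (c x : R) : `|x| <= c -> clamp c x = x.
Proof.
rewrite ler_norml /clamp => /andP[h1 h2].
by rewrite ger0_norm ?ler0_norm; [lra|lra|lra].
Qed.

Lemma continuous_clamp (c : R) (f : R -> R) : continuous f ->
  continuous (clamp c \o f).
Proof.
move=> cf t; apply: cvgM; last exact: cvg_cst.
by apply: cvgB; apply: cvg_norm; [apply: cvgD|apply: cvgB];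
  [exact: cf|exact: cvg_cst|exact: cf|exact: cvg_cst].
Qed.

Lemma half_pow_cvg (x : nat -> R) (l K : R) :
  (forall n, `|x n - l| <= K / 2 ^+ n) -> x @ \oo --> l.
Proof.
move=> xl; apply/cvgrPdist_lt => e e0; have [n nK] := half_pow_small e K e0.
exists n => // m /= nm; rewrite distrC (le_lt_trans _ nK)// (le_trans (xl m))//.
have K0 : 0 <= K by have := le_trans (normr_ge0 _) (xl 0%N);
  rewrite expr0 divr1.
by rewrite ler_wpM2l// lef_pV2 ?posrE ?exprn_gt0// ler_weXn2l// ler1n.
Qed.

(** Dividing out X - w shows that the difference is at most a constant times 1 - r. *)
Lemma poly_radial_limit q w (e : R) : normc w <= 1 -> 0 < e ->
  exists2 d, 0 < d & forall r : R, 0 <= r <= 1 -> 1 - r < d ->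
    normc (q.[(r%:C)%C * w] - q.[w]) < e.
Proof.
move=> w1 e0.
have /factor_theorem[q1 q1E] : root (q - q.[w]%:P) w.
  by rewrite rootE hornerD hornerN hornerC subrr.
have [Y Y0 qY] := poly_bounded_disk q1.
have Y1 : 0 < Y + 1 by rewrite ltr_wpDl.
exists (e / (Y + 1)); first by rewrite divr_gt0.
move=> r /andP[r0 r1]; rewrite ltr_pdivlMr// => rY.
have := congr1 (horner^~ ((r%:C)%C * w)) q1E; rewrite !hornerE /= => ->.
have -> : (r%:C)%C * w - w = - ((1 - r)%:C)%C * w by rewrite rmorphB rmorph1;
  ring.
rewrite !normcM normc_opp normc_real ger0_norm ?subr_ge0//.
have h : normc q1.[(r%:C)%C * w] <= Y.
  by apply: qY; rewrite normcM normc_real ger0_norm// mulr_ile1 ?normc_ge0.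
apply: le_lt_trans rY; rewrite mulrC; apply: ler_pM;
  rewrite ?mulr_ge0 ?subr_ge0 ?normc_ge0//.
  by rewrite ler_piMr// subr_ge0.
by rewrite (le_trans h)// lerDl.
Qed.

Lemma radial_limit_disk_algebra (S : nat -> {poly R[i]}) (G : R[i]^o ->
  R[i]^o) (K : R) w :
  (forall n z, normc z <= 1 -> normc ((S n).[z] - G z) <= K / 2 ^+ n) ->
  normc w = 1 -> G ((r%:C)%C * w) @[r --> (1 : R)^'-] --> G w.
Proof.
move=> SG w1; apply/cvgrPdist_lt => e; rewrite ltcE /= => /andP[/eqP Ime e0].
have e30 : 0 < Re e / 3 by rewrite divr_gt0.
have [n nK] := half_pow_small (Re e / 3) K e30.
have w1' : normc w <= 1 by rewrite w1.
have [d d0 dS] := poly_radial_limit (S n) w (Re e / 3) w1' e30.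
near=> r.
have r1 : r < 1 by near: r; exact: nbhs_left_lt.
have r0 : 0 < r by near: r; apply: nbhs_left_gt.
have rd : 1 - d < r by near: r; apply: nbhs_left_gt; rewrite gtrBl.
rewrite normr_normc ltcE /= Ime eqxx /=.
have rw1 : normc ((r%:C)%C * w) <= 1.
  by rewrite normcM normc_real w1 mulr1 ger0_norm ltW.
have h1 := SG n w w1'; have h2 := SG n ((r%:C)%C * w) rw1.
have r01 : 0 <= r <= 1 by rewrite !ltW.
have rd' : 1 - r < d by clear -rd; lra.
have h3 := dS r r01 rd'.
move: h1 h2 h3; set a := _ - G w; set b := _ - G (_ * w);
  set c := _ - (S n).[w].
move=> h1 h2 h3; have -> : G w - G ((r%:C)%C * w) = - a + b - c by rewrite /a
  /b /c; ring.
have := normcB (- a + b) c; have := normcD (- a) b; rewrite normc_opp.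
move: h1 h2 h3 nK; clear; lra.
Unshelve. all: by end_near. Qed.

(** Remainders shrink by 4 while [lam] doubles: the corrections, of size lam 2^n M / 4^n up to a
    factor 2, and the bad sets, of measure O(1 / (lam 2^n)), both decay like 2^(-n). *)
Lemma correction_sequence (f : R -> R) (M lam : R) : 68 <= lam -> 0 < M ->
  continuous f -> (forall t, `|f t| <= M) ->
  exists (q : nat -> {poly R[i]}) (B : nat -> set R),
    [/\ forall n z, normc z <= 1 -> normc (q n).[z] <= 2 * lam * M / 2 ^+ n,
        forall n, measurable (B n),
        forall n, (lebesgue_measure (B n) <= ((2 + 128 * pi) / lam / 2 ^+
          n)%:E)%E &
        forall t, 0 <= t <= 2 * pi -> (forall n, ~ B n t) ->
          forall n, `|f t - Re (\sum_(k < n) q k).[cis t]| <= M / 4 ^+ n].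
Proof.
move=> lam68 M0 cf fM.
(* The correction is chosen for all pairs of a stage and a function at once, under premises, so that
   a plain fixpoint can iterate it. *)
have /choice[T TP] : forall x : nat * (R -> R), exists y : {poly R[i]} * set R,
    continuous x.2 -> (forall t, `|x.2 t| <= M / 4 ^+ x.1) ->
    [/\ forall z, normc z <= 1 ->
          normc y.1.[z] <= 2 * (lam * 2 ^+ x.1) * (M / 4 ^+ x.1),
        measurable y.2,
        (lebesgue_measure y.2 <= ((2 + 128 * pi) / (lam * 2 ^+ x.1))%:E)%E &
        forall t, 0 <= t <= 2 * pi -> ~ y.2 t ->
          `|x.2 t - Re y.1.[cis t]| <= (M / 4 ^+ x.1) / 4].
  move=> [n g] /=; have [[cg gM]|no] := pselect (continuous g /\
    (forall t, `|g t| <= M / 4 ^+ n)); last first.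
    by exists (0, set0) => cg gM; case: no.
  have ln : 68 <= lam * 2 ^+ n.
    by rewrite (le_trans lam68)// ler_peMr ?(le_trans _ lam68)//
      exprn_ege1// ler1n.
  have Mn : 0 < M / 4 ^+ n by rewrite divr_gt0// exprn_gt0.
  by have [q [B ?]] := bounded_correction g _ _ ln Mn cg gM; exists (q, B).
(* Clamping keeps the remainders bounded also on the exceptional sets. *)
pose F := fix F n : R -> R := if n is n'.+1 then
  clamp (M / 4 ^+ n'.+1) \o (fun t => F n' t - Re (T (n',
    F n')).1.[cis t]) else f.
have FP n : continuous (F n) /\ (forall t, `|F n t| <= M / 4 ^+ n).
  elim: n => [|n [cF FM]]; first by split => // t; rewrite expr0 divr1.
  split; last by move=> t; apply: clamp_le; rewrite divr_ge0 ?ltW// exprn_gt0.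
  apply: continuous_clamp => t; apply: cvgB; first exact: cF.
  exact: (continuous_poly_cis _).1.
pose q n := (T (n, F n)).1; pose B n := (T (n, F n)).2.
have qB n := TP (n, F n) (FP n).1 (FP n).2.
exists q, B; split.
- move=> n z z1; have [/(_ z z1) /= h _ _ _] := qB n; apply: le_trans h _.
  rewrite le_eqVlt; apply/orP; left; apply/eqP.
  by rewrite -[4]/(2 * 2)%:R natrM exprMn; field; rewrite expf_neq0.
- by move=> n; have [] := qB n.
- move=> n; have [_ _ /= h _] := qB n; apply: le_trans h _.
  by rewrite invfM mulrA.
move=> t t2 nB n.
(* Off all bad sets the clamping never acts, so [F n] is the true remainder. *)
suff -> : f t - Re (\sum_(k < n) q k).[cis t] = F n t by exact: (FP n).2.
elim: n => [|n IH]; first by rewrite big_ord0 horner0 subr0.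
rewrite big_ord_recr /= hornerD ReD opprD addrA IH clamp_id//.
have [_ _ _ h] := qB n; rewrite exprSr [_ * 4]mulrC invfM mulrA mulrAC;
  exact: (h t t2 (nB n)).
Qed.

Lemma continuous_real_part (f : R -> R) (M eps : R) : 0 < M -> 0 < eps ->
  continuous f -> (forall t, `|f t| <= M) ->
  exists (G : R[i]^o -> R[i]^o) (B : set R),
    [/\ bounded_analytic G,
        forall w, normc w = 1 -> G ((r%:C)%C * w) @[r --> (1 : R)^'-] --> G w,
        measurable_fun [set: R] (fun t : R => Re (G (cis t))),
        measurable B /\ (lebesgue_measure B <= eps%:E)%E &
        forall t, 0 <= t <= 2 * pi -> ~ B t -> f t = Re (G (cis t))].
Proof.
move=> M0 eps0 cf fM; have pi0 := @pi_gt0 R.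
pose C : R := 2 + 128 * pi; have C0 : 0 < C by rewrite /C; lra.
(* The bad sets have total measure at most 2 C / lam, which this choice brings below [eps]. *)
pose lam := Num.max 68 (2 * C / eps).
have lam68 : 68 <= lam by rewrite le_max lexx.
have lam0 : 0 < lam by apply: lt_le_trans lam68.
have lamC : 2 * C / eps <= lam by rewrite le_max lexx orbT.
have [q [B [qb mB muB qf]]] := correction_sequence f M lam lam68 M0 cf fM.
pose S n := \sum_(k < n) q k; pose K := 2 * lam * M.
have K0 : 0 <= K by rewrite /K !mulr_ge0// ltW.
have S0 : S 0%N = 0 by rewrite /S big_ord0.
have Sq n z : normc z <= 1 -> normc ((S n.+1).[z] - (S n).[z]) <= K / 2 ^+ n.
  by move=> z1; rewrite /S big_ord_recr /= hornerD addrC addKr; exact: qb.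
have [G [SG dG]] := disk_algebra_limit S K K0 S0 Sq.
exists G, (\bigcup_n B n); split.
- split; first by move=> z; rewrite normr_normc -[1]/((1 : R)%:C)%C ltcR;
    exact: dG.
  exists (4 * K) => z; rewrite !normr_normc -[1]/((1 : R)%:C)%C ltcR lecR =>
    /ltW z1.
  by have := SG 0%N z z1; rewrite S0 horner0 sub0r normc_opp expr0 divr1.
- by move=> w; exact: radial_limit_disk_algebra SG.
- apply: (@measurable_fun_cvg _ _ R _ (fun n t => Re (S n).[cis t])).
  + by move=> n; apply: continuous_measurable_fun;
      exact: (continuous_poly_cis _).1.
  + move=> t _; apply: (@half_pow_cvg _ _ (4 * K)) => n.
    by rewrite -ReB (le_trans (Re_le_normc _))// SG// normc_cis.
- split; first exact: bigcupT_measurable.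
  apply: (@le_trans _ _ (\sum_(n <oo) lebesgue_measure (B n))%E).
    apply: measure_sigma_subadditive => //; exact: bigcupT_measurable.
  apply: (@le_trans _ _ (\sum_(n <oo) (eps / (2 ^ n.+1)%:R)%:E)%E); last first.
    by apply: epsilon_trick0; exact: ltW.
  apply: lee_nneseries => // n _; rewrite (le_trans (muB n))// lee_fin.
  rewrite natrX exprS invfM mulrA ler_pM2r ?invr_gt0 ?exprn_gt0// -/C.
  by rewrite ler_pdivrMr//; move: lamC; rewrite ler_pdivrMr//; clear; lra.
move=> t t2 nB; apply/eqP; rewrite -subr_eq0 -normr_eq0 eq_le normr_ge0 andbT.
apply: (@le_half_pow _ _ _ (M + 4 * K)) => n; rewrite add0r.
have h1 := qf t t2 (fun m Bm => nB (ex_intro2 _ _ m I Bm)) n.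
have c1 : normc (cis t) <= 1 by rewrite normc_cis.
have h2 := le_trans (Re_le_normc _) (SG n _ c1); rewrite ReB in h2.
have h3 : M / 4 ^+ n <= M / 2 ^+ n.
  by rewrite ler_pM2l// lef_pV2 ?posrE ?exprn_gt0// lerXn2r ?nnegrE// ler_nat.
have := ler_normD (f t - Re (S n).[cis t]) (Re (S n).[cis t] - Re (G (cis t))).
rewrite subrKA mulrDl; move: h1 h2 h3; rewrite -/(S n); clear; lra.
Qed.

End continuous_case.

(** * From Lebesgue measurable functions to continuous ones *)

Section lebesgue_measurable_functions.
Context {R : realType}.

(** The Lebesgue sigma-algebra is the completion of the Borel one, so [A] is a Borel set together
    with part of a Borel null set. *)
Lemma lebesgue_measurable_borelU (A : set R) : measurable (A : set
  (lebesgueType R)) ->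
  exists X Z : set R, [/\ measurable (X : set (measurableTypeR R)),
    measurable (Z : set (measurableTypeR R)),
    lebesgue_measure Z = 0%E & X `<=` A /\ A `<=` X `|` Z].
Proof.
move=> mA; have : (completed_algebra_gen (@lebesgue_measure
  R)).-sigma.-measurable A.
  by rewrite completed_caratheodory_measurable.
rewrite g_sigma_completed_algebra_genE => -[X mX [N [Z [mZ Z0 NZ]] <-]].
exists X, Z; split => //; split => [t Xt|t [Xt|/NZ Zt]]; by [left|right].
Qed.

(** The superlevel sets at rational heights are Borel up to null sets; [h] is set to 0 on the union
    of these countably many null sets. *)
Lemma borel_version (h : lebesgueType R -> R) : measurable_fun setT h ->
  exists (g : R -> R) (Z : set R),
    [/\ measurable_fun [set: measurableTypeR R] g,
      measurable (Z : set (measurableTypeR R)),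
        lebesgue_measure Z = 0%E & forall t, ~ Z t -> g t = h t].
Proof.
(* [e] enumerates the rationals, with default 0 where [unpickle] fails. *)
move=> mh; pose e n : R := ratr (odflt 0 (unpickle n)).
have /choice[X XP] : forall n, exists XZ : set R * set R,
    [/\ measurable (XZ.1 : set (measurableTypeR R)),
    measurable (XZ.2 : set (measurableTypeR R)),
    lebesgue_measure XZ.2 = 0%E & XZ.1 `<=` [set t | e n < h t] /\
    [set t | e n < h t] `<=` XZ.1 `|` XZ.2].
  move=> n; have := mh measurableT `]e n, +oo[%classic (measurable_itv _).
  rewrite setTI => /lebesgue_measurable_borelU[X0 [Z0 [? ? ? []]]].
  have -> : h @^-1` `]e n, +oo[%classic = [set t | e n < h t].
    by apply/seteqP; split => t /=; rewrite in_itv /= andbT.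
  by move=> ? ?; exists (X0, Z0).
pose Z := \bigcup_n (X n).2.
have mZ : measurable (Z : set (measurableTypeR R)).
  by apply: bigcupT_measurable => n; have [] := XP n.
have Z0 : lebesgue_measure Z = 0%E.
  apply: measure_negligible => //; apply: negligible_bigcup => n.
  by have [_ m2 z2 _] := XP n; exact/negligibleP.
exists (fun t => if pselect (Z t) then 0 else h t), Z; split => //; last first.
  by move=> t nZ; case: pselect.
move=> _; apply: (measurability _ (RGenOInfty.measurableE R)) => //
  _ [_ [r ->] <-].
rewrite setTI.
(* Off [Z] a rational separates [r] from [h t]; on [Z] the value 0 exceeds [r] exactly when
   [r < 0]. *)
rewrite (_ : _ @^-1` _ = (\bigcup_(n in [set n | r < e n]) ((X n).1 `\` Z)) `|`
  (if r < 0 then Z else set0)).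
  apply: measurableU; last by case: ifP.
  by apply: bigcup_measurable => n _; apply: measurableD => //; have [] := XP n.
apply/seteqP; split => t /=; rewrite in_itv /= andbT; case: pselect => /= Zt.
- by move=> ->; right.
- move=> rh; left; have /rat_in_itvoo[q] := rh.
  rewrite in_itv /= => /andP[rq qh].
  have eq : e (pickle q) = ratr q by rewrite /e pickleK.
  exists (pickle q); rewrite /= ?eq//; split => //.
  have [_ _ _ [_ /(_ t)]] := XP (pickle q); rewrite /= eq => /(_ qh)[//|Zt'].
  by exfalso; apply: Zt; exists (pickle q).
- by case=> [[n _ [_ /(_ Zt)]]//|]; case: ifP.
- case=> [[n /= rn [Xt _]]|]; last by case: ifP.
  by have [_ _ _ [/(_ t Xt) /= h1 _]] := XP n; exact: lt_trans h1.
Qed.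

(** Lusin's theorem gives a compact set on which the Borel version is continuous, hence bounded;
    Tietze's theorem extends it to the line with the same bound. *)
Lemma lebesgue_lusin (h : lebesgueType R -> R) (eps : R) : 0 < eps ->
  measurable_fun setT h ->
  exists (g : R -> R) (M : R) (B : set R),
    [/\ 0 < M, continuous g, forall t, `|g t| <= M,
        measurable (B : set (measurableTypeR R)) /\ (lebesgue_measure B <=
          eps%:E)%E &
        forall t, 0 <= t <= 2 * pi -> ~ B t -> g t = h t].
Proof.
move=> eps0 mh; have [g0 [Z [mg0 mZ Z0 g0h]]] := borel_version h mh.
pose D : set R := `[0, 2 * pi]%classic.
have mD : measurable (D : set (measurableTypeR R)) by exact: measurable_itv.
have finD : (lebesgue_measure D < +oo)%E.
  by rewrite lebesgue_measure_itv /=; case: ifP => _;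
    rewrite ?ltry// -EFinB ltry.
have mgD : measurable_fun (D : set (measurableTypeR R)) g0 by exact:
  measurable_funTS.
have [K [cK KD muK gK]] := measurable_almost_continuous mD finD eps0 mgD.
have /compact_bounded[M [_ Mb]] := continuous_compact gK cK.
have M0 : 0 < `|M| + 1 by rewrite ltr_wpDl.
have gM t : K t -> `|g0 t| <= `|M| + 1.
  by move=> Kt; apply: Mb; [rewrite ltr_pwDr// ler_norm|exists t].
have [||g [g0g cg gb]] := continuous_bounded_extension _ _ M0 gK gM.
- exact: pseudometric_normal.
- by apply: compact_closed => //; exact: Rhausdorff.
have mK : measurable (K : set (measurableTypeR R)) by exact: compact_measurable.
exists g, (`|M| + 1), (Z `|` (D `\` K)); split => //.
- split; first by apply: measurableU => //; exact: measurableD.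
  apply: le_trans (measureU2 lebesgue_measure mZ (measurableD mD mK)) _.
  rewrite -[eps%:E]add0e; apply: leeD; last exact: ltW.
  by rewrite le_eqVlt; apply/orP; left; apply/eqP; exact: Z0.
move=> t t2 nB; have Kt : K t.
  by apply: contrapT => nK; apply: nB; right.
by rewrite -g0g ?inE// g0h// => Zt; apply: nB; left.
Qed.

End lebesgue_measurable_functions.

(** * Transfer from the parameter interval to the circle *)

Theorem theorem1 (R : realType) (f : circle R -> R) (eps : R) :
  f \in Lfun (@arc_length R) +oo%E -> 0 < eps ->
  exists (g : circle R -> R[i]) (E : set (circle R)),
    [/\ Hoo g, measurable E, (arc_length (~` E) < eps%:E)%E &
        forall w : circle R, E w -> f w = complex.Re (g w)].
Proof.
move=> /sub_Lfun_mfun/set_mem mf eps0.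
have mexpi : measurable_fun [set: lebesgueType R] (expi : lebesgueType R ->
  circle R).
  by move=> _ A mA; exact: mA.
have mfexpi : measurable_fun [set: lebesgueType R] (f \o expi : lebesgueType
  R -> R).
  exact: measurableT_comp.
(* Two bad sets of measure at most eps / 4 leave room for the strict inequality. *)
have eps40 : 0 < eps / 4 by rewrite divr_gt0.
have [h [M [B1 [M0 ch hM [mB1 muB1] hf]]]] := lebesgue_lusin _ _ eps40 mfexpi.
have [G [B2 [baG radG mG [mB2 muB2] hG]]] := continuous_real_part h M (eps /
  4) M0 eps40 ch hM.
(* [E] is the whole coincidence set: measurability on the circle concerns the preimage in the entire
   line, whereas [B1] and [B2] account for one period only. *)
pose E := [set w : circle R | f w = Re (G (val w))].
exists (fun w => G (val w)), E; split => //.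
- exists G => //; apply: (@aeW _ _ _ arc_length) => w.
  apply: radG; have := valP w;
    rewrite normr_normc => /eqP/(congr1 (@complex.Re R)).
  exact.
- suff : measurable ([set: lebesgueType R] `&` (expi : lebesgueType R ->
    circle R) @^-1` E) by [].
  pose k t := f (expi t) - Re (G (cis t)).
  rewrite setTI (_ : _ @^-1` E = k @^-1` [set 0]).
    rewrite -[_ @^-1` _]setTI.
    suff : measurable_fun [set: lebesgueType R] (k : lebesgueType R -> R).
      by apply => //; exact: measurable_set1.
    apply: measurable_funB => //.
    move=> _ A mA; rewrite setTI; apply: sub_caratheodory.
    by have := mG measurableT A mA; rewrite setTI.
  apply/seteqP; split => t; rewrite /k /E /=; first by move=> ->; rewrite subrr.
  by move/eqP; rewrite subr_eq0 => /eqP.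
have sub : (expi : R -> circle R) @^-1` (~` E) `&` `[0,
  2 * pi[%classic `<=` B1 `|` B2.
  move=> t [/= nE]; rewrite in_itv /= => /andP[t0 t2];
    apply: contrapT => nB; apply: nE.
  have t02 : 0 <= t <= 2 * pi by rewrite t0 ltW.
  rewrite /E /= -[f _]/((f \o expi) t) -hf//; last by move=> ?; apply: nB; left.
  by rewrite hG// => ?; apply: nB; right.
apply: (@le_lt_trans _ _ (lebesgue_measure (B1 `|` B2))).
  (* Both sides are values of the same outer measure, so the inclusion of sets suffices. *)
  exact: le_outer_measure.
apply: (@le_lt_trans _ _ (eps / 4 + eps / 4)%:E).
  apply: le_trans (measureU2 lebesgue_measure mB1 mB2) _.
  by rewrite EFinD leeD.
by rewrite lte_fin; lra.
Qed.
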